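(* There is a numerical constant $C>0$ such that the following holds. Let $f:\mathbb{R}^d\to\mathbb{R}$ be $\ell$-smooth with $\ell>0$, let the stochastic gradient $g(x;\xi)$ be unbiased with variance bounded by $\sigma^2$, and let $f(x_0)-\min_{x\in\mathbb{R}^d}f(x)\le\Delta$. Run NSGD with momentum (NSGD-M), i.e. from an initial point $x_0$ and initial momentum $g_0$, for $t=0,1,2,\dots$, $$x_{t+1}=x_t-\frac{\gamma_t}{\|g_t\|}g_t,\qquad g_{t+1}=(1-\alpha_t)g_t+\alpha_t\,g(x_{t+1};\xi_{t+1}),$$ with $\alpha_t=\frac{\sqrt2}{\sqrt{t+2}}$ and $\gamma_t=\frac{\gamma}{(t+1)^{3/4}}$. Then for any $\gamma>0$ and every integer $T\ge2$, $$\frac1T\sum_{t=0}^{T-1}\mathbb{E}\|\nabla f(x_t)\|\le\frac{C\left(\frac{\Delta}{\gamma}+(\sigma+\ell\gamma)\log(T)\right)}{T^{1/4}}.$$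
   Context: A function $f:\mathbb{R}^d\to\mathbb{R}$ is $\ell$-smooth if it is differentiable and $\|\nabla f(x_1)-\nabla f(x_2)\|\le \ell\|x_1-x_2\|$ for all $x_1,x_2\in\mathbb{R}^d$. Stochastic gradient oracle: for every $x\in\mathbb{R}^d$, $\mathbb{E}_\xi[g(x;\xi)]=\nabla f(x)$ and $\mathbb{E}_\xi\|g(x;\xi)-\nabla f(x)\|^2\le\sigma^2$, with $\sigma\ge0$. The samples $\xi_1,\xi_2,\dots$ are drawn afresh at each iteration (independently of the past) from the distribution of $\xi$. If $g_t=0$, the update step of $x_t$ is taken to be zero. $x_0$ is a deterministic initial point, and $\log$ is the natural logarithm. A numerical constant is one that does not depend on any problem parameter, hyper-parameter, or on $T$. *)

(* Defs.v *)
From HB Require Import structures.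
From mathcomp Require Export all_boot all_order all_algebra.
From mathcomp Require Export finmap.
From mathcomp Require Export all_classical all_reals all_analysis.
Export Order.TTheory GRing.Theory Num.Theory.
Export numFieldNormedType.Exports.

Set Implicit Arguments.
Unset Strict Implicit.
Unset Printing Implicit Defensive.

Local Open Scope classical_set_scope.
Local Open Scope ring_scope.

(* R^d is 'rV[R]_d. The norm `|x| of the library on matrices is the sup norm;
   it defines the topology (hence differentiability), which in finite dimension
   is the Euclidean one, but all norms below are Euclidean. *)
Definition enorm (R : realType) (d : nat) (x : 'rV[R]_d) : R :=
  Num.sqrt (\sum_(i < d) x 0 i ^+ 2).

Definition grad (R : realType) (d : nat) (f : 'rV[R]_d -> R) (x : 'rV[R]_d) :
  'rV[R]_d := \row_(i < d) 'D_(delta_mx 0 i) f x.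

Definition smooth (R : realType) (d : nat) (l : R) (f : 'rV[R]_d -> R) : Prop :=
  (forall x, differentiable f x) /\
  (forall x1 x2, enorm (grad f x1 - grad f x2) <= l * enorm (x1 - x2)).

(* The Borel sigma-algebra of R^d, as the product sigma-algebra (the library
   has no measurable structure on row vectors). *)
Section row_vector_measurable.
Variables (R : realType) (d : nat).

Definition rV_measurable : set (set 'rV[R]_d) :=
  <<s \bigcup_(i in [set: 'I_d])
        preimage_set_system setT (fun x : 'rV[R]_d => x 0 i) measurable >>.

Let rV_measurable0 : rV_measurable set0.
Proof. exact: sigma_algebra0. Qed.

Let rV_measurableC A : rV_measurable A -> rV_measurable (~` A).
Proof. exact: sigma_algebraC. Qed.

Let rV_measurable_bigcup (F : (set 'rV[R]_d)^nat) :
  (forall i, rV_measurable (F i)) -> rV_measurable (\bigcup_i F i).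
Proof. exact: sigma_algebra_bigcup. Qed.

HB.instance Definition _ := @isMeasurable.Build default_measure_display
  'rV[R]_d rV_measurable rV_measurable0 rV_measurableC rV_measurable_bigcup.

End row_vector_measurable.

Definition mutually_independent (dO : measure_display)
    (Omega : measurableType dO) (R : realType) (P : probability Omega R)
    (I : choiceType) (E : I -> set (set Omega)) : Prop :=
  forall (J : {fset I}) (A : I -> set Omega), (forall i, i \in J -> E i (A i)) ->
    P (\bigcap_(i in [set` J]) A i) = (\prod_(i <- J) P (A i))%E.

(* The noise xi_1, xi_2, ... is i.i.d. with law Q and independent of the initial
   momentum g0, which may be random (e.g. a stochastic gradient at x0) or
   constant. The variable xi 0 plays no role; index 0 of the independent family
   is the sigma-algebra of g0. *)
Definition fresh_samples (dO dX : measure_display) (Omega : measurableType dO)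
    (Xi : measurableType dX) (R : realType) (d : nat) (P : probability Omega R)
    (Q : probability Xi R) (g0 : {RV P >-> 'rV[R]_d})
    (xi : nat -> {RV P >-> Xi}) : Prop :=
  (forall (t : nat) (A : set Xi), measurable A ->
     distribution P (xi t.+1) A = Q A) /\
  mutually_independent P (fun t : nat =>
    if t is s.+1 then g_sigma_algebra_preimage (xi s.+1)
    else g_sigma_algebra_preimage g0).

(* The expectation of a vector is taken coordinatewise. Unbiasedness implies
   integrability, since the integral of a measurable function that is not
   integrable is infinite in the library. *)
Definition stochastic_gradient (dX : measure_display) (Xi : measurableType dX)
    (R : realType) (d : nat) (Q : probability Xi R) (f : 'rV[R]_d -> R)
    (sigma : R) (g : 'rV[R]_d -> Xi -> 'rV[R]_d) : Prop :=
  [/\ measurable_fun [set: 'rV[R]_d * Xi] (uncurry g),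
      (forall x i, 'E_Q[fun z => g x z ord0 i] = (grad f x ord0 i)%:E)%E &
      (forall x, 'E_Q[fun z => (enorm (g x z - grad f x) ^+ 2)%R]
                   <= (sigma ^+ 2)%:E)%E ].

(* State (x_t, g_t) of normalized SGD with momentum along the noise sequence z;
   step t + 1 uses z t.+1. If g_t = 0, the step is zero, since 0 is scaled. *)
Fixpoint nsgdm (Xi : Type) (R : realType) (d : nat)
    (g : 'rV[R]_d -> Xi -> 'rV[R]_d) (gam alpha : nat -> R)
    (x0 g0 : 'rV[R]_d) (z : nat -> Xi) (t : nat) : 'rV[R]_d * 'rV[R]_d :=
  if t is s.+1 then
    let: (x, m) := nsgdm g gam alpha x0 g0 z s in
    let x' := x - (gam s / enorm m) *: m in
    (x', (1 - alpha s) *: m + alpha s *: g x' (z s.+1))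
  else (x0, g0).

(* Main.v *)
(* The error of the momentum splits as [m_t - grad f x_t = bias_t + noise_t].
   Since [alpha_0 = 1], the initial momentum is forgotten after one step, and
   [|bias_t| <= 2 l gamma / (t + 1)^(1/4)] holds surely by the recursion
   [bias_(t+1) = (1 - alpha_t) (bias_t + grad f x_t - grad f x_(t+1))].
   The noise satisfies [E |noise_t|^2 <= 3 sigma^2 / (t + 1)^(1/2)], as the fresh
   sample is centred and independent of the past. Summing the descent inequality
   [gamma_t |grad f x_t| <= f x_t - f x_(t+1) + 2 gamma_t |m_t - grad f x_t|
   + l gamma_t^2 / 2] leaves error terms of order [1 / (t + 1)], hence the
   logarithm. At [t = 0] the momentum is arbitrary; there one uses
   [gamma |grad f x_0| <= Delta + l gamma^2 / 2]. *)
Require Import Defs.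
From HB Require Import structures.
From mathcomp Require Import ring lra measurable_realfun.

Set Implicit Arguments.
Unset Strict Implicit.
Unset Printing Implicit Defensive.

Local Open Scope classical_set_scope.
Local Open Scope ring_scope.

(** * Euclidean norm and descent *)

Definition dot (R : realType) (d : nat) (x y : 'rV[R]_d) : R :=
  \sum_(i < d) x 0 i * y 0 i.

Section euclid.
Variables (R : realType) (d : nat).
Implicit Types (x y z : 'rV[R]_d) (a : R).

Lemma dotC x y : dot x y = dot y x.
Proof. by apply: eq_bigr => i _; rewrite mulrC. Qed.

Lemma dotDl x y z : dot (x + y) z = dot x z + dot y z.
Proof. by rewrite -big_split; apply: eq_bigr => i _; rewrite mxE mulrDl. Qed.

Lemma dotZl a x y : dot (a *: x) y = a * dot x y.
Proof. by rewrite /dot mulr_sumr; apply: eq_bigr => i _; rewrite mxE mulrA. Qed.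

Lemma dotDr x y z : dot x (y + z) = dot x y + dot x z.
Proof. by rewrite dotC dotDl !(dotC _ x). Qed.

Lemma dotZr a x y : dot x (a *: y) = a * dot x y.
Proof. by rewrite dotC dotZl dotC. Qed.

Lemma dotNr x y : dot x (- y) = - dot x y.
Proof. by rewrite -scaleN1r dotZr mulN1r. Qed.

Lemma dotNl x y : dot (- x) y = - dot x y.
Proof. by rewrite dotC dotNr dotC. Qed.

Lemma dot_ge0 x : 0 <= dot x x.
Proof. by apply: sumr_ge0 => i _; rewrite -expr2 sqr_ge0. Qed.

Lemma enorm_ge0 x : 0 <= enorm x.
Proof. exact: sqrtr_ge0. Qed.

Lemma enorm_sqr x : enorm x ^+ 2 = dot x x.
Proof.
rewrite sqr_sqrtr; first by apply: eq_bigr => i _; rewrite expr2.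
by apply: sumr_ge0 => i _; rewrite sqr_ge0.
Qed.

Lemma enorm0_eq0 x : enorm x = 0 -> x = 0.
Proof.
move=> x0; have /eqP : dot x x = 0 by rewrite -enorm_sqr x0 expr0n.
rewrite psumr_eq0 => [/allP xi0|i _]; last by rewrite -expr2 sqr_ge0.
apply/rowP => i; rewrite mxE.
by have := xi0 i (mem_index_enum i); rewrite /= -expr2 sqrf_eq0 => /eqP.
Qed.

Lemma enormZ a x : enorm (a *: x) = `|a| * enorm x.
Proof.
apply/eqP; rewrite -(eqrXn2 (n := 2)) ?mulr_ge0 ?enorm_ge0 ?normr_ge0//.
by rewrite exprMn !enorm_sqr dotZl dotZr real_normK ?num_real// mulrA expr2.
Qed.

Lemma enorm0 : enorm (0 : 'rV[R]_d) = 0.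
Proof. by rewrite -(scale0r 0) enormZ normr0 mul0r. Qed.

Lemma enormN x : enorm (- x) = enorm x.
Proof. by rewrite -scaleN1r enormZ normrN1 mul1r. Qed.

(** Cauchy-Schwarz: the squared length of |y|^2 x - <x, y> y equals |y|^2 (|x|^2 |y|^2 - <x, y>^2)
    and is nonnegative. *)
Lemma dot_le_enorm x y : dot x y <= enorm x * enorm y.
Proof.
have [y0|y_neq0] := eqVneq (enorm y) 0.
  rewrite y0 mulr0 (enorm0_eq0 y0) /dot big1// => i _.
  by rewrite mxE mulr0.
have y_gt0 : 0 < enorm y by rewrite lt0r y_neq0 enorm_ge0.
have : 0 <= dot (enorm y ^+ 2 *: x - dot x y *: y)
                (enorm y ^+ 2 *: x - dot x y *: y) by exact: dot_ge0.
rewrite !(dotDl, dotDr, dotNl, dotNr, dotZl, dotZr) (dotC y x) -!enorm_sqr => h.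
have {h} : 0 <= enorm y ^+ 2 * ((enorm x * enorm y) ^+ 2 - dot x y ^+ 2).
  by apply: le_trans h _; lra.
rewrite pmulr_rge0 ?exprn_gt0// subr_ge0 => h.
have [/ltW dxy0|dxy0] := ltP (dot x y) 0.
  by rewrite (le_trans dxy0)// mulr_ge0 ?enorm_ge0.
by rewrite -(ler_pXn2r (n := 2)) ?nnegrE ?mulr_ge0 ?enorm_ge0.
Qed.

Lemma enormD x y : enorm (x + y) <= enorm x + enorm y.
Proof.
rewrite -(ler_pXn2r (n := 2)) ?nnegrE ?addr_ge0 ?enorm_ge0//.
rewrite enorm_sqr !(dotDl, dotDr) (dotC y x) -!enorm_sqr.
have := dot_le_enorm x y; lra.
Qed.

Lemma enormB_ge x y : enorm x - enorm y <= enorm (x - y).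
Proof. by rewrite lerBlDr -{1}(subrK y x) enormD. Qed.

Lemma le_coord_enorm x i : `|x 0 i| <= enorm x.
Proof.
rewrite -(ler_pXn2r (n := 2)) ?nnegrE ?normr_ge0 ?enorm_ge0//.
rewrite enorm_sqr real_normK ?num_real// /dot (bigD1 i)//= -expr2 lerDl.
by apply: sumr_ge0 => j _; rewrite -expr2 sqr_ge0.
Qed.

(** Triangle inequality over the expansion in the standard basis, whose vectors have norm 1. *)
Lemma enorm_le_sum x : enorm x <= \sum_(i < d) `|x 0 i|.
Proof.
rewrite [in leLHS](row_sum_delta x).
elim: (index_enum _) => [|i s IH]; first by rewrite !big_nil enorm0.
rewrite !big_cons (le_trans (enormD _ _))// lerD// enormZ.
rewrite -[leRHS]mulr1 ler_wpM2l// /enorm (bigD1 i)//= big1 ?addr0; last first.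
  by move=> j ji; rewrite mxE eqxx (negbTE ji)/= expr0n.
by rewrite mxE !eqxx expr1n sqrtr1.
Qed.

End euclid.

(** * Descent along a normalized step *)

Section smooth_descent.
Variables (R : realType) (d : nat) (f : 'rV[R]_d -> R) (l : R).
Hypotheses (l_gt0 : 0 < l) (fs : smooth l f).
Implicit Types (x v u : 'rV[R]_d).

(** Differentiability makes the directional derivative linear in [v], hence determined by the
    partial derivatives. *)
Lemma derive_grad x v : 'D_v f x = dot (grad f x) v.
Proof.
have df := fs.1 x.
rewrite deriveE// [v in LHS]row_sum_delta linear_sum/=.
by apply: eq_bigr => i _; rewrite linearZ/= -deriveE// mxE mulrC.
Qed.

(** The difference quotient in [s] is that of [f] at [x + s *: v] in the direction [v]. *)
Lemma is_derive_line x v (s : R) :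
  is_derive s 1 (fun s : R => f (x + s *: v)) (dot (grad f (x + s *: v)) v).
Proof.
rewrite -derive_grad.
have df := fs.1 (x + s *: v).
have dfv := @diff_derivable _ _ _ f (x + s *: v) v df.
have key : (fun h : R => h^-1 *: (((fun s : R => f (x + s *: v)) \o shift s) (h *: 1)
            - f (x + s *: v))) =
           (fun h : R => h^-1 *: ((f \o shift (x + s *: v)) (h *: v) - f (x + s *: v))).
  apply/funext => h /=; congr (_ *: (f _ - _)).
  by rewrite /shift /= scalerDl addrCA /GRing.scale/= mulr1.
split; first by rewrite /derivable key.
by rewrite /derive key.
Qed.

Lemma smooth_descent x v :
  f (x + v) <= f x + dot (grad f x) v + l / 2 * enorm v ^+ 2.
Proof.
(* [f] along the segment minus its linear and quadratic terms. Cauchy-Schwarz and the Lipschitz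
   gradient make its derivative nonpositive on the open unit interval. *)
pose psi (s : R) := f (x + s *: v) - s * dot (grad f x) v - l / 2 * enorm v ^+ 2 * s ^+ 2.
have dpsi (s : R) : is_derive s (1 : R) psi
    (dot (grad f (x + s *: v)) v - dot (grad f x) v - l * enorm v ^+ 2 * s).
  have H := is_derive_line x v s.
  apply: is_derive_eq; rewrite /GRing.scale/=; lra.
have : psi 1 <= psi 0.
  apply: (@ler0_derive1_le_cc _ psi 0 1) => //.
  - move=> t; rewrite in_itv/= => /andP[t0 _].
    rewrite derive1E (@derive_val _ _ _ _ _ _ _ (dpsi t)) -dotNl -dotDl subr_le0.
    apply: le_trans (dot_le_enorm _ _) _.
    have := fs.2 (x + t *: v) x; rewrite addrAC subrr add0r enormZ (gtr0_norm t0) => h.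
    apply: le_trans (ler_wpM2r (enorm_ge0 v) h) _.
    by rewrite le_eqVlt; apply/orP; left; apply/eqP; ring.
  - by apply: derivable_within_continuous => t _; have [] := dpsi t.
  - by rewrite in_itv/= ler01 lexx.
  - by rewrite in_itv/= ler01 lexx.
by rewrite /psi scale1r scale0r addr0 mul0r expr0n expr1n /=; lra.
Qed.

(** Let G be the gradient and e = |m - G|. The first-order gain per unit length is <G, m> / |m| >=
    |m| - e >= |G| - 2 e, whatever the length of [m]. *)
Lemma normalized_step_descent x m c : 0 <= c ->
  c * enorm (grad f x) <= f x - f (x - (c / enorm m) *: m)
    + 2 * c * enorm (m - grad f x) + l / 2 * c ^+ 2.
Proof.
move=> c0; have lc0 : 0 <= l / 2 * c ^+ 2.
  by rewrite mulr_ge0 ?sqr_ge0// divr_ge0// ltW.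
have cG0 : 0 <= c * enorm (grad f x) by rewrite mulr_ge0 ?enorm_ge0.
(* A zero momentum gives no step, but then e = |G|, and the term 2 c e alone covers the left
   side. *)
have [m0|m_neq0] := eqVneq (enorm m) 0.
  by rewrite (enorm0_eq0 m0) scaler0 subr0 sub0r enormN; lra.
have m_gt0 : 0 < enorm m by rewrite lt0r m_neq0 enorm_ge0.
set e := enorm (m - grad f x).
have := smooth_descent x (- ((c / enorm m) *: m)).
rewrite enormN enormZ ger0_norm ?divr_ge0 ?enorm_ge0// divfK//.
rewrite dotNr dotZr.
have Ge : enorm (grad f x) - e <= enorm m.
  have := enormB_ge (grad f x) (grad f x - m).
  by rewrite subKr /e -(enormN (m - _)) opprB.
(* Write <G, m> = |m|^2 - <m - G, m>. *)
have : enorm m * (enorm m - e) <= dot (grad f x) m.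
  have := dot_le_enorm (m - grad f x) m.
  by rewrite dotDl dotNl -enorm_sqr -/e; lra.
move=> /(ler_wpM2l (divr_ge0 c0 (ltW m_gt0))); rewrite mulrA divfK// => h1 h2.
have := ler_wpM2l c0 Ge; lra.
Qed.

(** The step has length at most [c] in any direction, so Cauchy-Schwarz bounds the first-order
    change. This serves the first iteration, whose momentum is arbitrary. *)
Lemma normalized_step_increase x m c : 0 <= c ->
  f (x - (c / enorm m) *: m) <= f x + c * enorm (grad f x) + l / 2 * c ^+ 2.
Proof.
move=> c0; have vc : enorm (- ((c / enorm m) *: m)) <= c.
  rewrite enormN enormZ ger0_norm ?divr_ge0 ?enorm_ge0//.
  have [->|m0] := eqVneq (enorm m) 0; first by rewrite mulr0.
  by rewrite divfK.
have := smooth_descent x (- ((c / enorm m) *: m)).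
have := dot_le_enorm (grad f x) (- ((c / enorm m) *: m)).
have := ler_wpM2l (enorm_ge0 (grad f x)) vc.
have : l / 2 * enorm (- ((c / enorm m) *: m)) ^+ 2 <= l / 2 * c ^+ 2.
  rewrite ler_wpM2l ?divr_ge0 ?(ltW l_gt0)//.
  by rewrite ler_pXn2r ?nnegrE ?enorm_ge0.
lra.
Qed.

(** A step along the gradient itself has no error term and cannot end below the minimum. *)
Lemma grad_le_gap x c xmin : 0 <= c -> (forall y, f xmin <= f y) ->
  c * enorm (grad f x) <= f x - f xmin + l / 2 * c ^+ 2.
Proof.
move=> c0 fmin; have := normalized_step_descent x (grad f x) c0.
rewrite subrr enorm0; have := fmin (x - (c / enorm (grad f x)) *: grad f x).
lra.
Qed.

End smooth_descent.

(** * Step sizes *)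

Section step_sizes.
Variable R : realType.
Implicit Types (p q r : R) (t T : nat).

(** With a rational lower bound and the value of the square, linear arithmetic can handle the
    irrational constant. *)
Lemma sqrt2_bounds : (7 / 5 : R) <= Num.sqrt 2 /\ Num.sqrt 2 ^+ 2 = 2 :> R.
Proof.
have h : Num.sqrt 2 ^+ 2 = 2 :> R by rewrite sqr_sqrtr.
by split=> //; rewrite -(ler_pXn2r (n := 2)) ?nnegrE ?sqrtr_ge0// ?h; lra.
Qed.

(** Here [a] and [b] stand for the square roots of t + 1 and t + 2. *)
Lemma square_step (a b : R) : 1 <= a -> 0 < b -> b ^+ 2 = a ^+ 2 + 1 ->
  [/\ a <= b, b - a <= 1 / 2, b <= Num.sqrt 2 * a & Num.sqrt 2 <= b].
Proof.
move=> a1 b0 ba; have [r1 r2] := sqrt2_bounds.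
have aa : 1 <= a ^+ 2 by rewrite exprn_ege1.
split.
- by rewrite -(ler_pXn2r (n := 2)) ?nnegrE ?ba//; lra.
(* Otherwise b^2 >= (a + 1/2)^2 = a^2 + a + 1/4 > a^2 + 1, as a >= 1. *)
- rewrite leNgt; apply/negP => ab.
  have : (a + 1 / 2) ^+ 2 <= b ^+ 2 by rewrite ler_pXn2r ?nnegrE//; lra.
  rewrite ba; have -> : (a + 1 / 2) ^+ 2 = a ^+ 2 + a + 1 / 4 by field.
  lra.
- rewrite -(ler_pXn2r (n := 2)) ?nnegrE ?mulr_ge0//; [|lra..].
  by rewrite exprMn r2 ba; lra.
- by rewrite -(ler_pXn2r (n := 2)) ?nnegrE ?r2 ?ba//; lra.
Qed.

Lemma fourth_power_step p q : 1 <= p -> 0 < q -> q ^+ 4 = p ^+ 4 + 1 ->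
  [/\ p <= q, q ^+ 2 - p ^+ 2 <= 1 / 2, q ^+ 2 <= Num.sqrt 2 * p ^+ 2
    & Num.sqrt 2 <= q ^+ 2].
Proof.
move=> p1 q0 qp; have [|||pq ? ? ?] := @square_step (p ^+ 2) (q ^+ 2).
- by rewrite exprn_ege1.
- by rewrite exprn_gt0.
- by rewrite -!exprM.
by split=> //; move: pq; rewrite ler_pXn2r ?nnegrE//; lra.
Qed.

(** Induction step of the bias bound in units of [l * gamma], with [p] and [q] the fourth roots of t
    + 1 and t + 2. The term p^(-3) is the gradient drift over one step of length
    [gamma / p ^+ 3]. *)
Lemma bias_recursion p q : 1 <= p -> 0 < q -> q ^+ 4 = p ^+ 4 + 1 ->
  (1 - Num.sqrt 2 / q ^+ 2) * (2 / p + (p ^+ 3)^-1) <= 2 / q.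
Proof.
move=> p1 q0 qp; have [r1 r2] := sqrt2_bounds.
have [pq ba br _] := fourth_power_step p1 q0 qp.
set r := Num.sqrt 2 in r1 r2 br *.
have p0 : 0 < p by lra.
have -> : (1 - r / q ^+ 2) * (2 / p + (p ^+ 3)^-1) =
    (q ^+ 2 - r) * (2 * p ^+ 2 + 1) / (q ^+ 2 * p ^+ 3).
  by field; rewrite !gt_eqF.
rewrite ler_pdivrMr ?mulr_gt0 ?exprn_gt0//.
have -> : 2 / q * (q ^+ 2 * p ^+ 3) = 2 * q * p ^+ 3 by field; rewrite gt_eqF.
(* Indeed q (q - p) <= (q + p) (q - p) = q^2 - p^2 <= 1/2. *)
have h1 : 2 * (q * (q - p)) <= 1.
  have : q * (q - p) <= (q + p) * (q - p) by rewrite ler_wpM2r ?subr_ge0; lra.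
  have -> : (q + p) * (q - p) = q ^+ 2 - p ^+ 2 by ring.
  lra.
have a0 : 0 < p ^+ 2 by rewrite exprn_gt0.
have h2 := ler_wpM2r (ltW a0) h1.
have h3 : 7 / 5 * p ^+ 2 <= r * p ^+ 2 by rewrite ler_wpM2r// ltW.
rewrite -subr_ge0.
have -> : 2 * q * p ^+ 3 - (q ^+ 2 - r) * (2 * p ^+ 2 + 1) =
  2 * (r * p ^+ 2) + r - q ^+ 2 - 2 * (q * (q - p)) * p ^+ 2 by ring.
lra.
Qed.

(** Induction step of the noise bound in units of sigma^2. With a = p^2 and b = q^2, clearing
    denominators leaves a gain 6 sqrt(2) b, which beats 3/2 b + 2 a + 6 since a <= b and b >=
    sqrt(2). *)
Lemma noise_recursion p q : 1 <= p -> 0 < q -> q ^+ 4 = p ^+ 4 + 1 ->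
  (1 - Num.sqrt 2 / q ^+ 2) ^+ 2 * (3 / p ^+ 2) + (Num.sqrt 2 / q ^+ 2) ^+ 2
    <= 3 / q ^+ 2.
Proof.
move=> p1 q0 qp; have [r1 r2] := sqrt2_bounds.
have [pq ba br rb] := fourth_power_step p1 q0 qp.
have a0 : 0 < p ^+ 2 by rewrite exprn_gt0//; lra.
have b0 : 0 < q ^+ 2 by rewrite exprn_gt0.
have ab : p ^+ 2 <= q ^+ 2 by rewrite ler_pXn2r ?nnegrE//; lra.
move: (p ^+ 2) (q ^+ 2) (Num.sqrt 2) a0 b0 ab r1 r2 ba br rb => {p1 q0 qp pq}.
move=> a b r a0 b0 ab r1 r2 ba br rb.
have -> : (1 - r / b) ^+ 2 * (3 / a) + (r / b) ^+ 2 =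
    (3 * (b ^+ 2 - 2 * (r * b) + r ^+ 2) + r ^+ 2 * a) / (a * b ^+ 2).
  by field; rewrite !gt_eqF.
rewrite r2 ler_pdivrMr ?mulr_gt0 ?exprn_gt0//.
have -> : 3 / b * (a * b ^+ 2) = 3 * (a * b) by field; rewrite gt_eqF.
have h1 : b * (b - a) <= b * (1 / 2) by rewrite ler_wpM2l// ltW.
have h2 : 7 / 5 * b <= r * b by rewrite ler_wpM2r// ltW.
have -> : b ^+ 2 = b * (b - a) + a * b by ring.
lra.
Qed.

Lemma root4_pow (x : R) : 0 <= x -> (x `^ (1 / 4)) ^+ 4 = x.
Proof.
by move=> x0; rewrite -powR_mulrn ?powR_ge0// -powRrM divfK ?powRr1// pnatr_eq0.
Qed.

Lemma powR_three_fourths (x : R) : x `^ (3 / 4) = (x `^ (1 / 4)) ^+ 3.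
Proof. by rewrite -powR_mulrn ?powR_ge0// -powRrM; congr (_ `^ _); field. Qed.

Lemma sqrt_root4 (x : R) : 0 <= x -> Num.sqrt x = (x `^ (1 / 4)) ^+ 2.
Proof.
move=> x0; rewrite -[in LHS](root4_pow x0) (exprM _ 2 2) sqrtr_sqr.
by rewrite ger0_norm// sqr_ge0.
Qed.

(** Induction: ln (T + 1) = ln (T + 2) + ln (1 - 1 / (T + 2)), and ln (1 + u) <= u, so the logarithm
    grows by at least the new term. *)
Lemma harmonic_le_ln T : (0 < T)%N ->
  \sum_(0 <= t < T) (t.+1%:R)^-1 <= 1 + ln (T%:R : R).
Proof.
case: T => // T _; elim: T => [|T IH]; first by rewrite big_nat1 invr1 ln1 addr0.
rewrite big_nat_recr//=; apply: le_trans (lerD IH (lexx _)) _.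
rewrite -addrA lerD2l.
have T1 : 0 < T.+1%:R :> R by rewrite ltr0n.
have T2 : 0 < T.+2%:R :> R by rewrite ltr0n.
have -> : T.+1%:R = T.+2%:R * (1 + - (T.+2%:R)^-1) :> R.
  by rewrite mulrDr mulrN mulr1 divff ?gt_eqF// -(natr1 T.+1) addrK.
have T2V : 0 < 1 + - (T.+2%:R)^-1 :> R.
  by rewrite subr_gt0 invf_lt1// ltr1n.
rewrite lnM ?posrE//.
have := @le_ln1Dx R (- (T.+2%:R)^-1) _.
rewrite ltrN2 invf_lt1// ltr1n => /(_ isT).
by rewrite -[X in _ -> _ <= X]addr0 -addrA lerD2l -subr_le0 opprK.
Qed.

(** The additive 1 is absorbed by 2 ln T, since ln T >= ln 2 >= 1/2. *)
Lemma harmonic_le_3ln T : (2 <= T)%N ->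
  \sum_(0 <= t < T) (t.+1%:R)^-1 <= 3 * ln (T%:R : R).
Proof.
move=> T2; have := harmonic_le_ln (ltnW T2).
suff : 1 / 2 <= ln (T%:R : R) by lra.
have : ln (2 : R) <= ln T%:R.
  by rewrite ler_ln ?posrE ?ler_nat// ltr0n (leq_trans _ T2).
(* ln (1/2) <= -1/2, that is, ln 2 >= 1/2. *)
have := @le_ln1Dx R (- 2^-1) _.
have -> : 1 - 2^-1 = 2^-1 :> R by field.
rewrite lnV ?posrE//; lra.
Qed.

End step_sizes.

(** * Measurability of vector-valued maps *)

Section row_vector_measurability.
Variables (R : realType) (d : nat) (dW : measure_display) (W : measurableType dW).
Implicit Types (F G : W -> 'rV[R]_d).

Lemma measurable_coord (i : 'I_d) :
  measurable_fun [set: 'rV[R]_d] (fun x : 'rV[R]_d => x 0 i).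
Proof.
move=> _ A mA; apply: sub_sigma_algebra; exists i => //.
by exists A.
Qed.

(** It suffices to pull back generators, and each generator constrains a single coordinate. *)
Lemma measurable_fun_rV F :
  (forall i, measurable_fun setT (fun w => F w 0 i)) -> measurable_fun setT F.
Proof.
move=> mF; apply: (measurability (\bigcup_(i in [set: 'I_d])
  preimage_set_system setT (fun x : 'rV[R]_d => x 0 i) measurable)) => //.
move=> _ [_ [i _ [B mB <-]] <-]; rewrite !setTI.
by rewrite -[X in measurable X]setTI; exact: mF.
Qed.

Lemma measurable_fun_coord F i :
  measurable_fun setT F -> measurable_fun setT (fun w => F w 0 i).
Proof. exact: measurableT_comp (measurable_coord i). Qed.

Lemma measurable_rVD F G : measurable_fun setT F -> measurable_fun setT G ->
  measurable_fun setT (fun w => F w + G w).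
Proof.
move=> mF mG; apply: measurable_fun_rV => i; under eq_fun do rewrite mxE.
by apply: measurable_funD; exact: measurable_fun_coord.
Qed.

Lemma measurable_rVZ (c : W -> R) F : measurable_fun setT c ->
  measurable_fun setT F -> measurable_fun setT (fun w => c w *: F w).
Proof.
move=> mc mF; apply: measurable_fun_rV => i; under eq_fun do rewrite mxE.
by apply: measurable_funM => //; exact: measurable_fun_coord.
Qed.

Lemma measurable_rVN F : measurable_fun setT F ->
  measurable_fun setT (fun w => - F w).
Proof.
move=> mF; under eq_fun do rewrite -scaleN1r.
exact: measurable_rVZ.
Qed.

Lemma measurable_rVB F G : measurable_fun setT F -> measurable_fun setT G ->
  measurable_fun setT (fun w => F w - G w).
Proof. by move=> mF mG; apply: measurable_rVD => //; exact: measurable_rVN. Qed.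

Lemma measurable_dot F G : measurable_fun setT F -> measurable_fun setT G ->
  measurable_fun setT (fun w => dot (F w) (G w)).
Proof.
move=> mF mG; apply: measurable_sum => i.
by apply: measurable_funM; exact: measurable_fun_coord.
Qed.

Lemma measurable_enorm_sqr F : measurable_fun setT F ->
  measurable_fun setT (fun w => enorm (F w) ^+ 2).
Proof.
by move=> mF; under eq_fun do rewrite enorm_sqr; exact: measurable_dot.
Qed.

Lemma measurable_enorm F : measurable_fun setT F ->
  measurable_fun setT (fun w => enorm (F w)).
Proof.
move=> mF.
have -> : (fun w => enorm (F w)) = @Num.sqrt R \o (fun w => enorm (F w) ^+ 2).
  by apply/funext => w /=; rewrite sqrtr_sqr ger0_norm ?enorm_ge0.
apply: measurableT_comp; last exact: measurable_enorm_sqr.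
by apply: continuous_measurable_fun; exact: sqrt_continuous.
Qed.

End row_vector_measurability.

(* Rounding to the grid of mesh [1 / (n + 1)] takes countably many values, and
   [h] is the pointwise limit of its composites with these roundings. *)
Section lipschitz_measurable.
Variables (R : realType) (d : nat) (h : 'rV[R]_d -> R) (L : R).
Hypothesis hL : forall x y, `|h x - h y| <= L * enorm (x - y).

Let scaled_floor (n : nat) (x : 'rV[R]_d) : 'rV[int]_d :=
  \row_i Num.floor (n.+1%:R * x 0 i).

Let grid_point (n : nat) (k : 'rV[int]_d) : 'rV[R]_d :=
  \row_i ((k 0 i)%:~R / n.+1%:R).

Let measurable_on_grid n :
  measurable_fun setT (fun x => h (grid_point n (scaled_floor n x))).
Proof.
move=> _ B mB; rewrite setTI.
(* The value depends only on the integer vector [scaled_floor n x], so the preimage is a countable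
   union of fibres of [scaled_floor n]. *)
have -> : (fun x => h (grid_point n (scaled_floor n x))) @^-1` B =
   \bigcup_(k in [set k | B (h (grid_point n k))]) (scaled_floor n @^-1` [set k]).
  apply/seteqP; split => [x Bx|x [k Bk /= xk]]; first by exists (scaled_floor n x).
  by rewrite /= xk.
rewrite bigcup_mkcond; apply: countable_bigcupT_measurable => // k.
case: ifP => // _.
(* Each fibre is a box, a finite intersection of half-open coordinate slabs. *)
have -> : scaled_floor n @^-1` [set k] =
    \bigcap_(i in [set: 'I_d])
      (fun x => n.+1%:R * x 0 i) @^-1` `[(k 0 i)%:~R, (k 0 i + 1)%:~R[%classic.
  apply/seteqP; split => [x <- i _|x xk] /=.
    by rewrite in_itv/= !mxE floor_itv.
  apply/rowP => i; rewrite mxE; apply/eqP; rewrite floor_eq.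
  by have := xk i Logic.I; rewrite /= in_itv.
apply: fin_bigcap_measurable => // i _; rewrite -[X in measurable X]setTI.
have mi : measurable_fun setT (fun x : 'rV[R]_d => n.+1%:R * x 0 i).
  by apply: measurable_funM => //; exact: measurable_coord.
by apply: mi => //; exact: measurable_itv.
Qed.

Let grid_point_scaled_floor n x :
  enorm (x - grid_point n (scaled_floor n x)) <= d%:R * n.+1%:R^-1.
Proof.
apply: le_trans (enorm_le_sum _) _.
have -> : d%:R * n.+1%:R^-1 = \sum_(i < d) n.+1%:R^-1 :> R.
  by rewrite sumr_const card_ord mulr_natl.
apply: ler_sum => i _; rewrite !mxE.
have n0 : 0 < n.+1%:R :> R by rewrite ltr0n.
have := floor_itv (n.+1%:R * x 0 i) => /andP[fl fu].
rewrite -(ler_pM2l n0) -[X in X * _](gtr0_norm n0) -normrM mulrBr mulrCA.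
rewrite divff ?gt_eqF// mulr1 ger0_norm ?subr_ge0//.
by rewrite lerBlDl -intrD1 ltW.
Qed.

Lemma lipschitz_measurable : measurable_fun setT h.
Proof.
apply: (measurable_fun_cvg measurable_on_grid) => x _.
apply/cvgrPdist_le => e e0.
(* The sign of [L] is not fixed, so the rounding error is bounded with its absolute value. *)
have L0 : 0 <= `|L| * d%:R by rewrite mulr_ge0.
have : ((`|L| * d%:R) * @harmonic R n) @[n --> \oo] --> (`|L| * d%:R) * 0.
  by apply: cvgM; [exact: cvg_cst|exact: cvg_harmonic].
rewrite mulr0 => /cvgr0_norm_le => /(_ e e0); apply: filterS => n /=.
apply: le_trans; rewrite /harmonic [leRHS]ger0_norm ?mulr_ge0//.
apply: le_trans (hL _ _) _.
apply: le_trans (ler_wpM2r (enorm_ge0 _) (ler_norm L)) _.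
by rewrite -mulrA ler_wpM2l.
Qed.

End lipschitz_measurable.

(** Each partial derivative is Lipschitz with constant [l], as a coordinate is at most the Euclidean
    norm. *)
Lemma measurable_grad (R : realType) (d : nat) (f : 'rV[R]_d -> R) (l : R) :
  smooth l f -> measurable_fun setT (grad f).
Proof.
move=> [_ fl]; apply: measurable_fun_rV => i.
apply: (@lipschitz_measurable _ _ _ l) => x y; apply: le_trans (fl x y).
by have := le_coord_enorm (grad f x - grad f y) i; rewrite [X in `|X|]mxE [X in _ + X]mxE.
Qed.

(** * Independence of the past *)

Section independence_of_past.
Context (dO : measure_display) (Omega : measurableType dO) (R : realType).
Variables (P : probability Omega R) (E : nat -> set (set Omega)).
Hypotheses (E_measurable : forall i, E i `<=` measurable)
  (ET : forall i, E i setT) (EI : forall i, setI_closed (E i))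
  (E_indep : mutually_independent P E).

(** A pi-system generating the sigma-algebra of the families of index below [n]. *)
Definition past_cylinders (n : nat) : set (set Omega) :=
  [set \bigcap_(i in `I_n) F i | F in [set F | forall i, E i (F i)]].

(** Mutual independence is applied twice: to the indices up to [n] with [C] placed at [n], and to
    those below [n]. *)
Lemma past_cylinders_indep n A C : past_cylinders n A -> E n C ->
  P (A `&` C) = (P A * P C)%E.
Proof.
move=> [F /= EF <-] EC.
have finn := finite_II n.
pose J := fset_set `I_n.
pose F' i := if i == n then C else F i.
have nJ : n \notin J by rewrite in_fset_set// notin_setE /= ltnn.
have EF' i : E i (F' i) by rewrite /F'; case: eqP => [->|].
have F'F i : i \in J -> F' i = F i.
  by rewrite in_fset_set// inE /F' => /ltn_eqF ->.
have := E_indep (J := (n |` J)%fset) (fun i _ => EF' i).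
rewrite big_fsetU1//= /F' eqxx (eq_big_seq (fun i => P (F i))); last first.
  by move=> i /F'F; rewrite /F' => ->.
have -> : \bigcap_(i in [set` (n |` J)%fset]) F' i = (\bigcap_(i in `I_n) F i) `&` C.
  apply/seteqP; split=> [w Fw|w [Fw Cw] i /=].
    split; last by have := Fw n; rewrite /F' eqxx; apply; rewrite /= fset1U1.
    move=> i /= ni; have := Fw i; rewrite /F' ltn_eqF//; apply.
    by rewrite /= in_fset1U in_fset_set// mem_set ?orbT.
  rewrite in_fset1U => /orP[/eqP->|iJ]; first by rewrite /F' eqxx.
  by rewrite F'F//; apply: Fw; move: iJ; rewrite in_fset_set// inE.
move=> ->; rewrite muleC; congr (_ * _)%E.
rewrite -(E_indep (J := J) (fun i _ => EF i)).
by congr (P (\bigcap_(i in _) _)); rewrite fset_setK.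
Qed.

(** The finite measures A -> P (A and C) and A -> P C P A agree on the pi-system of cylinders and on
    the whole space, hence on the generated sigma-algebra. *)
Lemma past_indep n A C : <<s past_cylinders n >> A -> E n C ->
  P (A `&` C) = (P A * P C)%E.
Proof.
move=> sA EC; have mC := E_measurable EC.
have fC : P C \is a fin_num by exact: fin_num_measure.
have C0 : 0 <= fine (P C) by rewrite fine_ge0.
have mG : past_cylinders n `<=` measurable.
  move=> _ [F EF <-]; apply: bigcap_measurableType => k _.
  exact: E_measurable (EF k).
have -> : (P A * P C = mscale (NngNum C0) P A)%E.
  by rewrite /mscale/= fineK// muleC.
suff : mrestr P mC A = mscale (NngNum C0) P A by [].
apply: (@g_sigma_algebra_measure_unique _ _ _ (past_cylinders n) mG
  (fun=> setT) _ _ (mrestr P mC) (mscale (NngNum C0) P)) => //.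
- move=> _; exists (fun=> setT) => //.
  by apply/seteqP; split.
- by rewrite bigcup_const//; exists 0%N.
- move=> _ _ [F EF <-] [G EG <-]; exists (fun i => F i `&` G i).
    by move=> i; exact: EI.
  by rewrite bigcapI.
- move=> B pB; rewrite /= /mscale/= fineK// muleC.
  exact: (past_cylinders_indep pB EC).
- by move=> _; rewrite /= /mrestr setTI ltey_eq fC.
Qed.

Lemma past_sub n i A : (i < n)%N -> E i A -> <<s past_cylinders n >> A.
Proof.
move=> ni EA; apply: sub_sigma_algebra.
exists (fun j => if j == i then A else setT).
  by move=> j; case: eqP => [->|_]; [|exact: ET].
apply/seteqP; split=> [w /(_ i ni)|w Aw j _]; first by rewrite eqxx.
by case: eqP.
Qed.

End independence_of_past.

(** * Integrating out an independent sample *)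

Section tonelli_of_independent.
Context (dO dS dX : measure_display) (Omega : measurableType dO)
  (S : measurableType dS) (Xi : measurableType dX) (R : realType).
Variables (P : probability Omega R) (Q : probability Xi R).

(** The joint law of [Y] and [X] agrees on rectangles with the product of the law of [Y] and [Q], so
    they coincide and Tonelli applies. This takes the place of conditioning on the past. *)
Lemma ge0_integral_indep (Y : Omega -> S) (X : Omega -> Xi)
    (h : S * Xi -> \bar R) :
  measurable_fun setT Y -> measurable_fun setT X ->
  (forall B, measurable B -> P (X @^-1` B) = Q B) ->
  (forall A B, measurable A -> measurable B ->
     P (Y @^-1` A `&` X @^-1` B) = (P (Y @^-1` A) * P (X @^-1` B))%E) ->
  measurable_fun setT h -> (forall u, 0 <= h u)%E ->
  (\int[P]_w h (Y w, X w) = \int[P]_w \int[Q]_z h (Y w, z))%E.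
Proof.
move=> mY mX lawX indep mh h0.
pose Yf : {mfun Omega >-> S} := HB.pack Y (isMeasurableFun.Build _ _ _ _ _ mY).
have mYX := measurable_fun_pair mY mX.
pose YX : {mfun Omega >-> (S * Xi)%type} :=
  HB.pack (fun w => (Y w, X w)) (isMeasurableFun.Build _ _ _ _ _ mYX).
have <- : (\int[distribution P YX]_u h u = \int[P]_w h (Y w, X w))%E.
  by rewrite ge0_integral_distribution.
transitivity (\int[(distribution P Yf \x Q)%E]_u h u)%E.
  apply: eq_measure_integral => A mA _; apply/esym.
  apply: (@product_measure_unique _ _ _ _ _ (distribution P Yf) Q
    (distribution P YX)) => // B1 B2 mB1 mB2.
  by have := indep _ _ mB1 mB2; rewrite lawX.
rewrite fubini_tonelli1// ge0_integral_distribution//.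
  exact: measurable_fun_fubini_tonelli_F.
by move=> y; apply: integral_ge0.
Qed.

End tonelli_of_independent.

(** * Second moment of one oracle call at a fixed point *)

Section oracle_second_moment.
Context (dX : measure_display) (Xi : measurableType dX) (R : realType) (d : nat).
Variables (Q : probability Xi R) (f : 'rV[R]_d -> R) (sigma : R)
  (g : 'rV[R]_d -> Xi -> 'rV[R]_d).
Hypothesis oracle : stochastic_gradient Q f sigma g.
Variables (x b : 'rV[R]_d) (c1 c2 : R).

Let n z := g x z - grad f x.

Let mg : measurable_fun setT (g x).
Proof. by have [m _ _] := oracle; exact: (measurable_fun_pair2 x m). Qed.

Let mn : measurable_fun setT n.
Proof. by apply: measurable_rVB. Qed.

Let int_sqr : Q.-integrable setT (fun z => (enorm (n z) ^+ 2)%:E).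
Proof.
apply/integrableP; split; first exact/measurable_EFinP/measurable_enorm_sqr.
under eq_integral do rewrite gee0_abs ?lee_fin ?sqr_ge0//.
have [_ _ v] := oracle; have := v x; rewrite unlock => /le_lt_trans; apply.
exact: ltry.
Qed.

Let int_cst (c : R) : Q.-integrable setT (fun=> c%:E).
Proof. exact: finite_measure_integrable_cst. Qed.

Let integral_cstE (c : R) : (\int[Q]_z c%:E = c%:E)%E.
Proof. by have := expectation_cst Q c; rewrite unlock. Qed.

Let int_coord i : Q.-integrable setT (fun z => (n z 0 i)%:E).
Proof.
apply: (le_integrable _ _ _ (integrableD _ (int_cst 1) int_sqr)) => //.
  exact/measurable_EFinP/measurable_fun_coord.
move=> z _; rewrite -EFinD !abse_EFin lee_fin.
(* A coordinate is dominated by 1 + |n z|^2, because (|n z| - 1)^2 >= 0. *)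
have := le_coord_enorm (n z) i; have := sqr_ge0 (enorm (n z) - 1).
rewrite [X in _ -> _ -> _ <= X]ger0_norm ?addr_ge0 ?sqr_ge0//; nra.
Qed.

Let mean_coord i : (\int[Q]_z (n z 0 i)%:E = 0)%E.
Proof.
have [_ m _] := oracle; have := m x i; rewrite unlock.
under eq_integral => z _.
  rewrite (_ : g x z ord0 i = n z 0 i + grad f x 0 i); last by rewrite !mxE subrK.
  rewrite EFinD.
  over.
rewrite (integralD measurableT (int_coord i) (int_cst (grad f x 0 i))).
rewrite integral_cstE.
(* Finiteness is needed to cancel the gradient in the extended reals. *)
have : (\int[Q]_z (n z 0 i)%:E)%E \is a fin_num by exact: integrable_fin_num.
case: (\int[Q]_z (n z 0 i)%:E)%E => // r _ [h].
by congr _%:E; apply: (addIr (grad f x 0 i)); rewrite add0r.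
Qed.

Let dotE z : ((dot b (n z))%:E = \sum_(i < d) (b 0 i)%:E * (n z 0 i)%:E)%E.
Proof. by rewrite -sumEFin. Qed.

Let int_dot : Q.-integrable setT (fun z => (dot b (n z))%:E).
Proof.
apply: (eq_integrable _ (fun z => \sum_(i < d) (b 0 i)%:E * (n z 0 i)%:E)%E) => //.
by apply: integrable_sum => // i _; exact: integrableZl.
Qed.

Let mean_dot : (\int[Q]_z (dot b (n z))%:E = 0)%E.
Proof.
under eq_integral do rewrite dotE.
rewrite integral_sum//=; last by move=> i; exact: (integrableZl measurableT (b 0 i) (int_coord i)).
by rewrite big1// => i _; rewrite integralZl// mean_coord mule0.
Qed.

(** Expand the square: the cross term is linear in the centred noise and integrates to 0, since [b]
    is fixed. *)
Lemma oracle_second_moment :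
  (\int[Q]_z (enorm (c1 *: b + c2 *: (g x z - grad f x)) ^+ 2)%:E
     <= (c1 ^+ 2 * enorm b ^+ 2 + c2 ^+ 2 * sigma ^+ 2)%:E)%E.
Proof.
have -> : (\int[Q]_z (enorm (c1 *: b + c2 *: (g x z - grad f x)) ^+ 2)%:E =
  \int[Q]_z ((c1 ^+ 2 * enorm b ^+ 2)%:E
    + ((2 * c1 * c2)%:E * (dot b (n z))%:E
    + (c2 ^+ 2)%:E * (enorm (n z) ^+ 2)%:E)))%E.
  apply: eq_integral => z _; rewrite -!EFinM -!EFinD; congr _%:E.
  rewrite -/(n z); move: (n z) => v.
  rewrite !enorm_sqr !(dotDl, dotDr, dotZl, dotZr) (dotC v b).
  ring.
have int1 := integrableZl measurableT (2 * c1 * c2) int_dot.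
have int2 := integrableZl measurableT (c2 ^+ 2) int_sqr.
rewrite (integralD measurableT (int_cst _) (integrableD measurableT int1 int2)).
rewrite (integralD measurableT int1 int2) integral_cstE.
rewrite (integralZl measurableT int_dot) mean_dot mule0 add0e.
rewrite (integralZl measurableT int_sqr) EFinD leeD2l// (EFinM (c2 ^+ 2) (sigma ^+ 2)).
apply: lee_wpmul2l; rewrite ?lee_fin ?sqr_ge0//.
by have [_ _ v] := oracle; have := v x; rewrite unlock.
Qed.

End oracle_second_moment.

(** * Noise of the iterates *)

Section iterates.
Variables (Xi : Type) (R : realType) (d : nat) (f : 'rV[R]_d -> R)
  (g : 'rV[R]_d -> Xi -> 'rV[R]_d) (gam alpha : nat -> R) (x0 : 'rV[R]_d).
Implicit Types (z : nat -> Xi) (t : nat).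

Definition position (g0 : 'rV[R]_d) z t := (nsgdm g gam alpha x0 g0 z t).1.
Definition momentum (g0 : 'rV[R]_d) z t := (nsgdm g gam alpha x0 g0 z t).2.

Lemma positionS (g0 : 'rV[R]_d) z t : position g0 z t.+1 = position g0 z t -
  (gam t / enorm (momentum g0 z t)) *: momentum g0 z t.
Proof. by rewrite /position /momentum /=; case: nsgdm. Qed.

Lemma momentumS (g0 : 'rV[R]_d) z t : momentum g0 z t.+1 = (1 - alpha t) *: momentum g0 z t +
  alpha t *: g (position g0 z t.+1) (z t.+1).
Proof. by rewrite positionS /position /momentum /=; case: nsgdm. Qed.

(** Stated as a function of the past data [x], [b] and the sample [u], so that [u] can be integrated
    with the past frozen. *)
Definition noise_step (c : R) (x b : 'rV[R]_d) (u : Xi) : 'rV[R]_d :=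
  (1 - c) *: b + c *: (g x u - grad f x).

(* The contribution of the oracle noise to the error [momentum - grad f position]. *)
Fixpoint momentum_noise (g0 : 'rV[R]_d) z t : 'rV[R]_d :=
  if t is s.+1 then
    noise_step (alpha s) (position g0 z s.+1) (momentum_noise g0 z s) (z s.+1)
  else 0.

End iterates.

Section iterates_measurable.
Context (dX dW : measure_display) (Xi : measurableType dX) (W : measurableType dW).
Variables (R : realType) (d : nat) (f : 'rV[R]_d -> R)
  (g : 'rV[R]_d -> Xi -> 'rV[R]_d) (gam alpha : nat -> R) (x0 : 'rV[R]_d).
Hypotheses (mg : measurable_fun [set: 'rV[R]_d * Xi] (uncurry g))
  (mf : measurable_fun setT (grad f)).

Local Notation pos := (position g gam alpha x0).
Local Notation mom := (momentum g gam alpha x0).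
Local Notation noise := (momentum_noise f g gam alpha x0).

Lemma measurable_oracle (X : W -> 'rV[R]_d) (Z : W -> Xi) :
  measurable_fun setT X -> measurable_fun setT Z ->
  measurable_fun setT (fun w => g (X w) (Z w)).
Proof. by move=> mX mZ; exact: measurableT_comp mg (measurable_fun_pair mX mZ). Qed.

Lemma measurable_noise_step (c : R) (X B : W -> 'rV[R]_d) (Z : W -> Xi) :
  measurable_fun setT X -> measurable_fun setT B -> measurable_fun setT Z ->
  measurable_fun setT (fun w => noise_step f g c (X w) (B w) (Z w)).
Proof.
move=> mX mB mZ; apply: measurable_rVD; apply: measurable_rVZ => //.
apply: measurable_rVB; first exact: measurable_oracle.
exact: measurableT_comp mf mX.
Qed.

Lemma measurable_normalized_step (c : R) (X M : W -> 'rV[R]_d) :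
  measurable_fun setT X -> measurable_fun setT M ->
  measurable_fun setT (fun w => X w - (c / enorm (M w)) *: M w).
Proof.
move=> mX mM; apply: measurable_rVB => //; apply: measurable_rVZ => //.
apply: measurable_funM => //.
(* Inversion agrees with the power -1 on nonnegative reals, including at 0. *)
have -> : (fun w => (enorm (M w))^-1) = (@powR R ^~ (-1)) \o (fun w => enorm (M w)).
  by apply/funext => w /=; rewrite powR_inv1 ?enorm_ge0.
apply: measurableT_comp; last exact: measurable_enorm.
exact: measurable_powR.
Qed.

(** The source space is arbitrary: both [Omega] and the sigma-algebra of the past are used. Position
    [t.+1] is listed at stage [t] because it involves samples only up to index [t]. *)
Lemma measurable_iterates (g0 : W -> 'rV[R]_d) (z : nat -> W -> Xi) t :
  measurable_fun setT g0 ->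
  (forall s, (s < t)%N -> measurable_fun setT (z s.+1)) ->
  [/\ measurable_fun setT (fun w => pos (g0 w) (z^~ w) t),
      measurable_fun setT (fun w => mom (g0 w) (z^~ w) t),
      measurable_fun setT (fun w => pos (g0 w) (z^~ w) t.+1) &
      measurable_fun setT (fun w => noise (g0 w) (z^~ w) t)].
Proof.
move=> mg0; elim: t => [|t IH] mz.
  split => //.
  by apply: measurable_normalized_step.
have [|mpos mmom mpos' mnoise] := IH; first by move=> s st; apply: mz; exact: ltnW.
have mzt := mz t (ltnSn t).
have mmom' : measurable_fun setT (fun w => mom (g0 w) (z^~ w) t.+1).
  under eq_fun do rewrite momentumS.
  apply: measurable_rVD; apply: measurable_rVZ => //.
  exact: measurable_oracle.
split => //.
  by under eq_fun do rewrite positionS; exact: measurable_normalized_step.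
exact: measurable_noise_step.
Qed.

End iterates_measurable.

Section noise_moment.
Context (dX dO : measure_display) (Xi : measurableType dX)
  (Omega : measurableType dO) (R : realType) (d : nat).
Variables (Q : probability Xi R) (P : probability Omega R)
  (f : 'rV[R]_d -> R) (l sigma : R) (g : 'rV[R]_d -> Xi -> 'rV[R]_d)
  (gam alpha : nat -> R) (x0 : 'rV[R]_d) (g0 : {RV P >-> 'rV[R]_d})
  (xi : nat -> {RV P >-> Xi}).
Hypotheses (fs : smooth l f) (oracle : stochastic_gradient Q f sigma g)
  (fresh : fresh_samples Q g0 xi).

Let mf := measurable_grad fs.
Let mg : measurable_fun [set: 'rV[R]_d * Xi] (uncurry g).
Proof. by case: oracle. Qed.

Let x t w := position g gam alpha x0 (g0 w) (fun s => xi s w) t.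
Let b t w := momentum_noise f g gam alpha x0 (g0 w) (fun s => xi s w) t.

Let E (t : nat) : set (set Omega) :=
  if t is s.+1 then g_sigma_algebra_preimage (xi s.+1)
  else g_sigma_algebra_preimage g0.

Let preimageE (dT : measure_display) (T : measurableType dT)
  (Z : {mfun Omega >-> T}) A : g_sigma_algebra_preimage Z A ->
  exists2 B, measurable B & A = Z @^-1` B.
Proof. by move=> [B mB <-]; exists B => //; rewrite setTI. Qed.

Let E_measurable t : E t `<=` measurable.
Proof.
by case: t => [|t] A /preimageE[B mB ->]; exact: measurable_funPTI.
Qed.

Let ET t : E t setT.
Proof. by case: t => [|t]; exists setT => //; rewrite setTI preimage_setT. Qed.

Let EI t : setI_closed (E t).
Proof.
by case: t => [|t] _ _ [A mA <-] [B mB <-]; exists (A `&` B);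
  rewrite ?setTI// ; exact: measurableI.
Qed.

(** The past at [t.+1] is generated by [g0] and the samples 1 to [t]; position [t.+1] and noise [t]
    are determined by these, before sample [t.+1] is drawn. *)
Let measurable_before t :
  [/\ measurable_fun [set: g_sigma_algebraType (past_cylinders E t.+1)] (x t.+1)
    & measurable_fun [set: g_sigma_algebraType (past_cylinders E t.+1)] (b t)].
Proof.
have [|s st|_ _ mx mb] := @measurable_iterates _ _ Xi
  (g_sigma_algebraType (past_cylinders E t.+1)) R d f g gam alpha x0 mg mf
  g0 xi t.
- move=> _ B mB; rewrite setTI; apply: (past_sub ET (ltn0Sn t)).
  by exists B => //; rewrite setTI.
- move=> _ B mB; rewrite setTI; apply: (past_sub ET (i := s.+1)) => //.
  by exists B => //; rewrite setTI.
- by split.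
Qed.

Let measurable_on_Omega t :
  [/\ measurable_fun [set: Omega] (x t.+1) & measurable_fun [set: Omega] (b t)].
Proof.
by have [] := @measurable_iterates _ _ Xi Omega R d f g gam alpha x0 mg mf
  g0 xi t.
Qed.

(** The new noise is a function of the past pair [Y] and the fresh sample. Integrating the sample
    first reduces the claim to the oracle bound at each fixed value of [Y]. *)
Lemma noise_second_moment_step t :
  (\int[P]_w (enorm (b t.+1 w) ^+ 2)%:E <=
   ((1 - alpha t) ^+ 2)%:E * \int[P]_w (enorm (b t w) ^+ 2)%:E
    + (alpha t ^+ 2 * sigma ^+ 2)%:E)%E.
Proof.
have [mx mb] := measurable_on_Omega t.
have [mx' mb'] := measurable_before t.
pose Y w := (x t.+1 w, b t w).
pose h (u : ('rV[R]_d * 'rV[R]_d) * Xi) : \bar R :=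
  (enorm (noise_step f g (alpha t) u.1.1 u.1.2 u.2) ^+ 2)%:E.
have mb2 : measurable_fun setT (fun w => (enorm (b t w) ^+ 2)%:E).
  exact/measurable_EFinP/measurable_enorm_sqr.
have mY : measurable_fun setT Y by exact: measurable_fun_pair.
have mh : measurable_fun setT h.
  apply/measurable_EFinP/measurable_enorm_sqr.
  by apply: (measurable_noise_step mg mf); do ?[apply: measurableT_comp => //].
have -> : (\int[P]_w (enorm (b t.+1 w) ^+ 2)%:E = \int[P]_w h (Y w, xi t.+1 w))%E.
  by [].
rewrite (@ge0_integral_indep _ _ _ _ _ _ _ P Q)//.
- have -> : (((1 - alpha t) ^+ 2)%:E * \int[P]_w (enorm (b t w) ^+ 2)%:E
    + (alpha t ^+ 2 * sigma ^+ 2)%:E =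
    \int[P]_w (((1 - alpha t) ^+ 2)%:E * (enorm (b t w) ^+ 2)%:E
    + (alpha t ^+ 2 * sigma ^+ 2)%:E))%E.
    have k0 : (0 <= ((1 - alpha t) ^+ 2)%:E)%E by rewrite lee_fin sqr_ge0.
    rewrite ge0_integralD//.
    + rewrite ge0_integralZl//; last by move=> w _; rewrite lee_fin sqr_ge0.
      congr (_ + _)%E; have := expectation_cst P (alpha t ^+ 2 * sigma ^+ 2).
      by rewrite unlock.
    + by move=> w _; rewrite mule_ge0// lee_fin sqr_ge0.
    + exact: measurable_funeM.
    + by move=> w _; rewrite lee_fin mulr_ge0// sqr_ge0.
  apply: ge0_le_integral => //.
  + by move=> w _; apply: integral_ge0 => z _; rewrite lee_fin sqr_ge0.
  + have mF : measurable_fun setT (fubini_F Q h).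
      by apply: measurable_fun_fubini_tonelli_F => // u; rewrite lee_fin sqr_ge0.
    exact: (measurableT_comp mF mY).
  + by apply: emeasurable_funD => //; exact: measurable_funeM.
  + move=> w _; rewrite -EFinM -EFinD.
    exact: (oracle_second_moment oracle).
- by move=> B mB; have [+ _] := fresh; apply.
- move=> A B mA mB.
  apply: (past_indep E_measurable ET EI fresh.2 (n := t.+1)).
    have := measurable_fun_pair mx' mb'; move=> /(_ measurableT A mA).
    by rewrite setTI.
  by exists B => //; rewrite setTI.
- by move=> u; rewrite lee_fin sqr_ge0.
Qed.

End noise_moment.

(** * Pathwise bound *)

Section schedule.
Variables (R : realType) (gamma : R).

(** Both schedules are expressed by integer powers of this root, which turns the estimates into
    rational inequalities. *)
Definition root4 (t : nat) : R := t.+1%:R `^ (1 / 4).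
Definition alpha_sched (t : nat) : R := Num.sqrt 2 / Num.sqrt (t + 2)%:R.
Definition gamma_sched (t : nat) : R := gamma / ((t + 1)%:R `^ (3 / 4)).

Lemma root4_exp4 t : root4 t ^+ 4 = t.+1%:R.
Proof. by rewrite root4_pow. Qed.

Lemma root4_exp4S t : root4 t.+1 ^+ 4 = root4 t ^+ 4 + 1.
Proof. by rewrite !root4_exp4 natr1. Qed.

Lemma root4_gt0 t : 0 < root4 t.
Proof. by rewrite powR_gt0// ltr0n. Qed.

Lemma root4_ge1 t : 1 <= root4 t.
Proof.
rewrite -(ler_pXn2r (n := 4)) ?nnegrE//; last by rewrite ltW// root4_gt0.
by rewrite expr1n root4_exp4 ler1n.
Qed.

Lemma le_root4 s t : (s <= t)%N -> root4 s <= root4 t.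
Proof.
move=> st; rewrite -(ler_pXn2r (n := 4)) ?nnegrE ?(ltW (root4_gt0 _))//.
by rewrite !root4_exp4 ler_nat.
Qed.

Lemma alpha_schedE t : alpha_sched t = Num.sqrt 2 / root4 t.+1 ^+ 2.
Proof. by rewrite /alpha_sched addn2 (@sqrt_root4 _ t.+2%:R). Qed.

Lemma gamma_schedE t : gamma_sched t = gamma / root4 t ^+ 3.
Proof. by rewrite /gamma_sched addn1 powR_three_fourths. Qed.

Lemma alpha_sched0 : alpha_sched 0 = 1.
Proof. by rewrite /alpha_sched add0n divff// sqrtr_eq0 -ltNge. Qed.

Lemma alpha_sched_le1 t : alpha_sched t <= 1.
Proof.
have [_ _ _ h] := fourth_power_step (root4_ge1 t) (root4_gt0 t.+1) (root4_exp4S t).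
by rewrite alpha_schedE ler_pdivrMr ?mul1r// exprn_gt0// root4_gt0.
Qed.

End schedule.

Arguments root4_exp4 {R} t.
Arguments root4_exp4S {R} t.
Arguments root4_gt0 {R} t.
Arguments root4_ge1 {R} t.

Section pathwise.
Variables (Xi : Type) (R : realType) (d : nat) (f : 'rV[R]_d -> R)
  (l sigma Delta gamma : R) (g : 'rV[R]_d -> Xi -> 'rV[R]_d)
  (x0 g0 : 'rV[R]_d) (z : nat -> Xi).
Hypotheses (l_gt0 : 0 < l) (fs : smooth l f) (sigma_ge0 : 0 <= sigma)
  (gamma_gt0 : 0 < gamma).

Let gam := gamma_sched gamma.
Let alpha := @alpha_sched R.
Let p := @root4 R.
Let x t := position g gam alpha x0 g0 z t.
Let m t := momentum g gam alpha x0 g0 z t.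
Let b t := momentum_noise f g gam alpha x0 g0 z t.
Let s := sigma + l * gamma.

Let gam_gt0 t : 0 < gam t.
Proof. by rewrite /gam gamma_schedE divr_gt0// exprn_gt0// root4_gt0. Qed.

(** The fresh oracle value cancels between momentum and noise, so only the gradient drift feeds the
    bias. *)
Lemma bias_step t : m t.+1 - grad f (x t.+1) - b t.+1 =
  (1 - alpha t) *: ((m t - grad f (x t) - b t) + (grad f (x t) - grad f (x t.+1))).
Proof.
rewrite /m momentumS -/(m t) -/(x t.+1).
rewrite /b /= -/(b t) /noise_step -/(x t.+1).
move: (grad f (x t.+1)) (grad f (x t)) (g _ _) => u v w.
by apply/rowP => i; rewrite !mxE; ring.
Qed.

(** Induction from index 1, where the bias is 0 because [alpha 0 = 1]; afterwards each drift is at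
    most [l * gam t]. *)
Lemma bias_le t :
  enorm (m t.+1 - grad f (x t.+1) - b t.+1) <= l * gamma * (2 / p t.+1).
Proof.
have lg0 : 0 < l * gamma by rewrite mulr_gt0.
elim: t => [|t IH]; rewrite bias_step enormZ.
  rewrite /alpha alpha_sched0 subrr normr0 mul0r mulr_ge0 ?(ltW lg0)//.
  by rewrite divr_ge0// ltW// root4_gt0.
have a1 : 0 <= 1 - alpha t.+1 by rewrite subr_ge0 alpha_sched_le1.
rewrite ger0_norm//.
have step : enorm (grad f (x t.+1) - grad f (x t.+2)) <= l * gam t.+1.
  apply: le_trans (fs.2 _ _) _; rewrite ler_wpM2l ?(ltW l_gt0)//.
  rewrite [x t.+2]positionS subKr enormZ.
  rewrite ger0_norm ?divr_ge0 ?enorm_ge0 ?(ltW (gam_gt0 _)) ?(ltW gamma_gt0)//.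
  have [->|m0] := eqVneq (enorm (momentum g gam alpha x0 g0 z t.+1)) 0.
    by rewrite mulr0 ltW.
  by rewrite divfK.
apply: le_trans (ler_wpM2l a1 (le_trans (enormD _ _) (lerD IH step))) _.
rewrite /alpha alpha_schedE /gam gamma_schedE.
have h := bias_recursion (root4_ge1 t.+1) (root4_gt0 t.+2) (@root4_exp4S R t.+1).
apply: le_trans (ler_wpM2l (ltW lg0) h).
by rewrite le_eqVlt; apply/orP; left; apply/eqP; rewrite /p; ring.
Qed.

(** Sum of the coefficients of 1 / (t + 1) in one step: 4 l gamma^2 from the bias, gamma s from
    splitting the noise, l gamma^2 / 2 from the curvature. *)
Let c := gamma * (9 / 2 * (l * gamma) + s).
(** This is [gam t * (p t / s)], the coefficient of the squared noise after AM-GM. *)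
Let weight t := gamma / (s * p t ^+ 2).

(** Descent with the error split into bias and noise. The noise is left squared, the form in which
    its expectation is controlled. *)
Lemma step_bound t : gam t.+1 * enorm (grad f (x t.+1)) <=
  f (x t.+1) - f (x t.+2) + c / t.+2%:R + weight t.+1 * enorm (b t.+1) ^+ 2.
Proof.
have lg0 : 0 < l * gamma by rewrite mulr_gt0.
have s0 : 0 < s by rewrite /s ltr_wpDl.
have p0 : 0 < p t.+1 := root4_gt0 _.
have := normalized_step_descent l_gt0 fs (x t.+1) (m t.+1) (ltW (gam_gt0 t.+1)).
rewrite -positionS -/(x t.+2).
have err : enorm (m t.+1 - grad f (x t.+1)) <=
    l * gamma * (2 / p t.+1) + enorm (b t.+1).
  rewrite -{1}(subrK (b t.+1) (m t.+1 - grad f (x t.+1))).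
  by apply: le_trans (enormD _ _) _; rewrite lerD2r bias_le.
(* AM-GM with weight [s / p], where [s = sigma + l gamma > 0] even if [sigma = 0]. *)
have amgm : 2 * enorm (b t.+1) <= s / p t.+1 + p t.+1 / s * enorm (b t.+1) ^+ 2.
  have := mulr_ge0 (divr_ge0 (ltW p0) (ltW s0)) (sqr_ge0 (s / p t.+1 - enorm (b t.+1))).
  rewrite (_ : _ * (_ - _) ^+ 2 = s / p t.+1 + p t.+1 / s * enorm (b t.+1) ^+ 2
     - 2 * enorm (b t.+1)); first by rewrite subr_ge0.
  by field; rewrite !gt_eqF.
have -> : t.+2%:R = p t.+1 ^+ 4 :> R by rewrite /p root4_exp4.
rewrite /weight; move: (enorm (b t.+1)) (enorm_ge0 (b t.+1)) err amgm => B B0 err amgm.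
have h1 := ler_wpM2l (ltW (gam_gt0 t.+1)) err.
have h2 := ler_wpM2l (ltW (gam_gt0 t.+1)) amgm.
have gamE : gam t.+1 = gamma / p t.+1 ^+ 3 by rewrite /gam gamma_schedE.
(* The curvature term decays like p^(-6), which is at most p^(-4) since p >= 1. *)
have h3 : l / 2 * gam t.+1 ^+ 2 <= (l * gamma ^+ 2) / 2 / p t.+1 ^+ 4.
  rewrite gamE (_ : l / 2 * _ = (l * gamma ^+ 2) / 2 / p t.+1 ^+ 6); last first.
    by field; rewrite gt_eqF.
  apply: ler_wpM2l; first by rewrite divr_ge0// mulr_ge0 ?sqr_ge0// ltW.
  by rewrite lef_pV2 ?posrE ?exprn_gt0// ler_weXn2l// root4_ge1.
have -> : c / p t.+1 ^+ 4 = 2 * (gam t.+1 * (l * gamma * (2 / p t.+1)))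
   + gam t.+1 * (s / p t.+1) + (l * gamma ^+ 2) / 2 / p t.+1 ^+ 4.
  by rewrite gamE /c; field; rewrite gt_eqF.
have -> : gamma / (s * p t.+1 ^+ 2) * B ^+ 2 = gam t.+1 * (p t.+1 / s * B ^+ 2).
  by rewrite gamE; field; rewrite !gt_eqF.
lra.
Qed.

Variables (xmin : 'rV[R]_d).
Hypotheses (fmin : forall y, f xmin <= f y) (gap : f x0 - f xmin <= Delta).

(** No momentum error is available here. The increase bound gives gamma |G| <= f x_0 - f x_1 + 2
    gamma |G| + l gamma^2 / 2, and the gap bound on gamma |G| is used twice. *)
Lemma first_step_bound : gam 0 * enorm (grad f (x 0)) <=
  f (x 0) - f (x 1) + 2 * Delta + c / 1%:R.
Proof.
have lg0 : 0 < l * gamma by rewrite mulr_gt0.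
have gam0 : gam 0 = gamma by rewrite /gam /gamma_sched add0n powR1 divr1.
have := normalized_step_increase l_gt0 fs (x 0) (m 0) (ltW (gam_gt0 0)).
rewrite -positionS -/(x 1).
have := grad_le_gap l_gt0 fs (x 0) (ltW (gam_gt0 0)) fmin.
rewrite gam0 -[in f (x 0) - f xmin]/x0.
(* The curvature terms total 3/2 l gamma^2; this is the surplus of [c] over them. *)
have : 0 <= gamma * (3 * (l * gamma) + s).
  by apply: mulr_ge0; [exact: ltW|]; rewrite /s !addr_ge0// ?mulr_ge0// ltW.
have -> : l / 2 * gamma ^+ 2 = gamma * (l * gamma) / 2 by field.
rewrite divr1 /c.
have : gamma * (9 / 2 * (l * gamma) + s) =
  gamma * (3 * (l * gamma) + s) + 3 / 2 * (gamma * (l * gamma)) by field.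
by move=> ->; move: gap; rewrite /x /position /=; lra.
Qed.

Lemma weighted_sum_bound T :
  \sum_(0 <= t < T.+1) gam t * enorm (grad f (x t)) <=
  f x0 - f (x T.+1) + 2 * Delta + c * (\sum_(0 <= t < T.+1) t.+1%:R^-1)
    + \sum_(0 <= t < T.+1) weight t * enorm (b t) ^+ 2.
Proof.
elim: T => [|T IH].
  (* The noise starts at 0, so its term at index 0 vanishes. *)
  rewrite !big_nat1 invr1 mulr1 [b 0]/= enorm0 expr0n /= mulr0 addr0.
  by have := first_step_bound; rewrite divr1.
rewrite !(big_nat_recr T.+1)//= mulrDr.
by have := step_bound T; move: (c / T.+2%:R) => u; lra.
Qed.

(** For t < T, 1 / T <= gam t / (gamma T^(1/4)), because T^(3/4) >= (t + 1)^(3/4). The function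
    values telescope to at most [Delta], the third one. *)
Lemma mean_grad_bound T : (2 <= T)%N ->
  T%:R^-1 * \sum_(0 <= t < T) enorm (grad f (x t)) <=
  (gamma * T%:R `^ (1 / 4))^-1 * (3 * Delta + c * (3 * ln T%:R)
    + \sum_(0 <= t < T) weight t * enorm (b t) ^+ 2).
Proof.
case: T => // T T2.
have -> : T.+1%:R `^ (1 / 4) = p T by [].
have pT : 0 < p T := root4_gt0 _.
apply: (@le_trans _ _ ((gamma * p T)^-1 *
    \sum_(0 <= t < T.+1) gam t * enorm (grad f (x t)))).
  rewrite !mulr_sumr; apply: ler_sum_nat => t /andP[_ tT].
  rewrite mulrA ler_wpM2r ?enorm_ge0// /gam gamma_schedE -root4_exp4 -/p.
  have pt : 0 < p t := root4_gt0 _.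
  have -> : (gamma * p T)^-1 * (gamma / p t ^+ 3) = (p T * p t ^+ 3)^-1.
    by field; rewrite !gt_eqF.
  rewrite lef_pV2 ?posrE ?mulr_gt0 ?exprn_gt0// (exprS _ 3) ler_wpM2l ?(ltW pT)//.
  by rewrite ler_pXn2r ?nnegrE ?(ltW pt) ?(ltW pT)// le_root4.
rewrite ler_wpM2l ?invr_ge0 ?mulr_ge0 ?(ltW pT) ?(ltW gamma_gt0)//.
apply: le_trans (weighted_sum_bound T) _; rewrite lerD2r.
have c0 : 0 <= c.
  by rewrite /c /s !(mulr_ge0, addr_ge0, divr_ge0)// ltW.
apply: lerD; first by have := gap; have := fmin (x T.+1); lra.
by apply: ler_wpM2l => //; exact: harmonic_le_3ln.
Qed.

End pathwise.

(** * Bound in expectation *)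

Section expected_bound.
Context (dX dO : measure_display) (Xi : measurableType dX)
  (Omega : measurableType dO) (R : realType) (d : nat).
Variables (Q : probability Xi R) (P : probability Omega R)
  (f : 'rV[R]_d -> R) (l sigma Delta gamma : R) (g : 'rV[R]_d -> Xi -> 'rV[R]_d)
  (x0 xmin : 'rV[R]_d) (g0 : {RV P >-> 'rV[R]_d}) (xi : nat -> {RV P >-> Xi}).
Hypotheses (l_gt0 : 0 < l) (fs : smooth l f) (sigma_ge0 : 0 <= sigma)
  (oracle : stochastic_gradient Q f sigma g) (fmin : forall y, f xmin <= f y)
  (gap : f x0 - f xmin <= Delta) (fresh : fresh_samples Q g0 xi)
  (gamma_gt0 : 0 < gamma).

Let x t w := position g (gamma_sched gamma) (@alpha_sched R) x0 (g0 w)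
  (fun s => xi s w) t.
Let b t w := momentum_noise f g (gamma_sched gamma) (@alpha_sched R) x0 (g0 w)
  (fun s => xi s w) t.

(** Induction from zero noise, with [noise_recursion] scaled by sigma^2. *)
Lemma noise_second_moment t :
  (\int[P]_w (enorm (b t w) ^+ 2)%:E <= (3 * sigma ^+ 2 / root4 R t ^+ 2)%:E)%E.
Proof.
elim: t => [|t IH].
  rewrite integral0_eq ?lee_fin; last by move=> w _; rewrite enorm0 expr0n.
  by rewrite !mulr_ge0 ?invr_ge0 ?sqr_ge0.
apply: le_trans (noise_second_moment_step _ _ _ fs oracle fresh t) _.
apply: le_trans (leeD2r _ (lee_wpmul2l _ IH)) _; first by rewrite lee_fin sqr_ge0.
rewrite -EFinM -EFinD lee_fin alpha_schedE.
have := noise_recursion (root4_ge1 t) (root4_gt0 t.+1) (@root4_exp4S R t).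
move=> h; have := ler_wpM2l (sqr_ge0 sigma) h.
move: (root4 R t) (root4 R t.+1) (Num.sqrt 2) => p q r; lra.
Qed.

Let measurable_iter t : measurable_fun setT (x t) /\ measurable_fun setT (b t).
Proof.
have [mg _ _] := oracle.
by have [] := @measurable_iterates _ _ Xi Omega R d f g (gamma_sched gamma)
  (@alpha_sched R) x0 mg (measurable_grad fs) g0 xi t.
Qed.

Let s := sigma + l * gamma.
Let c := gamma * (9 / 2 * (l * gamma) + s).

(** The pathwise bound is integrated term by term; all integrands are nonnegative, so the exchanges
    hold in the extended reals. *)
Lemma expected_mean_grad_bound T : (2 <= T)%N ->
  ((T%:R^-1)%:E * \sum_(0 <= t < T) \int[P]_w (enorm (grad f (x t w)))%:E <=
   ((gamma * T%:R `^ (1 / 4))^-1 *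
    (3 * Delta + c * (3 * ln T%:R)
       + \sum_(0 <= t < T) 3 * gamma * sigma * t.+1%:R^-1))%:E)%E.
Proof.
move=> T2.
have mN t : measurable_fun setT (fun w => (enorm (grad f (x t w)))%:E).
  apply/measurable_EFinP/measurable_enorm.
  exact: measurableT_comp (measurable_grad fs) (measurable_iter t).1.
have mB t : measurable_fun setT (fun w => (enorm (b t w) ^+ 2)%:E).
  by apply/measurable_EFinP/measurable_enorm_sqr; exact: (measurable_iter t).2.
have T0 : 0 < T%:R :> R by rewrite ltr0n (leq_trans _ T2).
have s0 : 0 < s by rewrite /s ltr_wpDl// mulr_gt0.
have q0 : 0 < gamma * T%:R `^ (1 / 4) by rewrite mulr_gt0// powR_gt0.
set k := (gamma * T%:R `^ (1 / 4))^-1; have k0 : 0 <= k by rewrite invr_ge0 ltW.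
set D := 3 * Delta + c * (3 * ln T%:R).
have D0 : 0 <= D.
  rewrite addr_ge0 ?mulr_ge0//.
  - by apply: le_trans gap; rewrite subr_ge0.
  - by rewrite ltW.
  - by rewrite addr_ge0 ?ltW// mulr_gt0// mulr_gt0.
  - by rewrite ln_ge0// ler1n ltnW.
pose W t : R := gamma / (s * root4 R t ^+ 2).
have W0 t : 0 <= W t.
  by rewrite divr_ge0 ?(ltW gamma_gt0)// mulr_ge0 ?(ltW s0)// sqr_ge0.
rewrite -ge0_integral_sum//; last by move=> t w _; rewrite lee_fin enorm_ge0.
rewrite -ge0_integralZl//; last 2 first.
- exact: emeasurable_sum.
- by move=> w _; apply: sume_ge0 => t _; rewrite lee_fin enorm_ge0.
apply: (@le_trans _ _ (\int[P]_w
    (k%:E * (D%:E + \sum_(0 <= t < T) (W t)%:E * (enorm (b t w) ^+ 2)%:E)))%E).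
  apply: ge0_le_integral => //.
  - move=> w _; rewrite mule_ge0 ?lee_fin ?invr_ge0 ?(ltW T0)//.
    by apply: sume_ge0 => t _; rewrite lee_fin enorm_ge0.
  - by apply: measurable_funeM; exact: emeasurable_sum.
  - apply: measurable_funeM; apply: emeasurable_funD => //.
    by apply: emeasurable_sum => t; exact: measurable_funeM.
  - move=> w _; rewrite sumEFin -EFinM.
    have -> : (\sum_(0 <= t < T) (W t)%:E * (enorm (b t w) ^+ 2)%:E =
        (\sum_(0 <= t < T) W t * enorm (b t w) ^+ 2)%:E)%E by rewrite -sumEFin.
    rewrite -EFinD -EFinM lee_fin.
    exact: (mean_grad_bound g (g0 w) (xi^~ w) l_gt0 fs sigma_ge0 gamma_gt0 fmin gap T2).
have mWB t : measurable_fun setT (fun w => (W t)%:E * (enorm (b t w) ^+ 2)%:E)%E.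
  exact: measurable_funeM.
have WB0 t w : (0 <= (W t)%:E * (enorm (b t w) ^+ 2)%:E)%E.
  by rewrite mule_ge0// lee_fin ?sqr_ge0.
rewrite ge0_integralZl//; last 2 first.
- by apply: emeasurable_funD => //; exact: emeasurable_sum.
- by move=> w _; rewrite adde_ge0// sume_ge0.
rewrite ge0_integralD//; last 2 first.
- by move=> w _; rewrite sume_ge0.
- exact: emeasurable_sum.
have -> : (\int[P]_w D%:E = D%:E)%E.
  by have := expectation_cst P D; rewrite unlock.
rewrite ge0_integral_sum//.
rewrite EFinM; apply: lee_wpmul2l => //; rewrite (EFinD D) leeD2l//.
rewrite -sumEFin; apply: lee_sum => t _.
rewrite ge0_integralZl ?lee_fin//; last by move=> w _; rewrite lee_fin sqr_ge0.
apply: le_trans (lee_wpmul2l _ (noise_second_moment t)) _; first by rewrite lee_fin.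
rewrite -EFinM lee_fin -(root4_exp4 t).
have p0 : 0 < root4 R t := root4_gt0 t.
(* One factor [sigma / s] is split off; it is at most 1 as s = sigma + l gamma. *)
have -> : W t * (3 * sigma ^+ 2 / root4 R t ^+ 2) =
   (3 * gamma * sigma * (root4 R t ^+ 4)^-1) * (sigma / s).
  by rewrite /W; field; rewrite !gt_eqF.
rewrite ler_piMr//.
  by rewrite !mulr_ge0 ?invr_ge0 ?exprn_ge0 ?(ltW p0) ?(ltW gamma_gt0).
by rewrite ler_pdivrMr// mul1r lerDl mulr_ge0 ?(ltW l_gt0) ?(ltW gamma_gt0).
Qed.

End expected_bound.

Theorem proposition2 (R : realType) :
  exists2 C : R, 0 < C &
  forall (d : nat) (f : 'rV[R]_d -> R) (l sigma Delta gamma : R)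
    (dX dO : measure_display)
    (Xi : measurableType dX) (Q : probability Xi R)
    (g : 'rV[R]_d -> Xi -> 'rV[R]_d)
    (Omega : measurableType dO) (P : probability Omega R)
    (x0 : 'rV[R]_d) (g0 : {RV P >-> 'rV[R]_d}) (xi : nat -> {RV P >-> Xi}),
  0 < l -> smooth l f ->
  0 <= sigma -> stochastic_gradient Q f sigma g ->
  (exists2 xmin, forall x, f xmin <= f x & f x0 - f xmin <= Delta) ->
  fresh_samples Q g0 xi ->
  0 < gamma ->
  let alpha (t : nat) : R := Num.sqrt 2 / Num.sqrt (t + 2)%:R in
  let gam (t : nat) : R := gamma / ((t + 1)%:R `^ (3 / 4)) in
  let x (t : nat) (w : Omega) : 'rV[R]_d :=
    (nsgdm g gam alpha x0 (g0 w) (fun s => xi s w) t).1 in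
  forall T : nat, (2 <= T)%N ->
  ((T%:R^-1)%:E * \sum_(0 <= t < T) 'E_P[fun w => enorm (grad f (x t w))]
     <= (C * (Delta / gamma + (sigma + l * gamma) * ln T%:R)
           / (T%:R `^ (1 / 4)))%:E)%E.
Proof.
(* The final coefficients are 3 for Delta / gamma, 33/2 for l gamma ln T and 12 for sigma ln T; 17
   exceeds them all. *)
exists 17 => // d f l sigma Delta gamma dX dO Xi Q g Omega P x0 g0 xi.
move=> l0 fs sigma0 oracle [xmin fmin gap] fresh gamma0 alpha gam x T T2.
have := expected_mean_grad_bound l0 fs sigma0 oracle fmin gap fresh gamma0 T2.
under [X in _ -> (_ * X <= _)%E]eq_bigr do rewrite unlock.
move=> /le_trans; apply; rewrite lee_fin.
have T0 : 0 < T%:R :> R by rewrite ltr0n (leq_trans _ T2).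
have q0 : 0 < T%:R `^ (1 / 4) :> R by rewrite powR_gt0.
(* Both sides carry the factor T^(-1/4), which is cancelled. *)
rewrite invfM [leLHS]mulrAC ler_pM2r ?invr_gt0//.
rewrite -mulr_sumr.
have hT := harmonic_le_3ln R T2.
have Delta0 : 0 <= Delta by apply: le_trans gap; rewrite subr_ge0.
have L0 : 0 <= ln (T%:R : R) by rewrite ln_ge0// ler1n ltnW.
set L := ln _ in hT L0 *; set H := \sum_(0 <= t < T) _ in hT *.
apply: (@le_trans _ _ (gamma^-1 * (3 * Delta
  + gamma * (9 / 2 * (l * gamma) + (sigma + l * gamma)) * (3 * L)
  + 3 * gamma * sigma * (3 * L)))).
  rewrite ler_wpM2l ?invr_ge0 ?(ltW gamma0)// lerD2l ler_wpM2l//.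
  by rewrite !mulr_ge0// ltW.
have -> : gamma^-1 * (3 * Delta
  + gamma * (9 / 2 * (l * gamma) + (sigma + l * gamma)) * (3 * L)
  + 3 * gamma * sigma * (3 * L)) =
  3 * (Delta / gamma) + 33 / 2 * (l * gamma * L) + 12 * (sigma * L).
  by field; rewrite gt_eqF.
have h1 : 0 <= Delta / gamma by rewrite divr_ge0// ltW.
have h2 : 0 <= l * gamma * L by rewrite !mulr_ge0// ltW.
have h3 : 0 <= sigma * L by rewrite mulr_ge0.
lra.
Qed.
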